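(* Let $G$ be a group. (1) If $G\times\mathbb{Z}$ has $\mathrm{FGFP_a}$, then $G$ has $\mathrm{FGFP_a}$ and $S\mathbb{Q}(G)\subset\Sigma^1(G)$; this last inclusion is equivalent to: every homomorphism $\alpha: G\to\mathbb{Z}$ has finitely generated kernel. (2) If $G\times\mathbb{Z}^m$ has $\mathrm{FGFP_a}$ for some $m\geq \mathrm{rk}(H^1(G;\mathbb{Z}))$, then $G\times\mathbb{Z}^n$ has $\mathrm{FGFP_a}$ for every $0\leq n\leq m$, and $\Sigma^1(G)=S(G)$; this last equality is equivalent to: the derived subgroup $[G,G]$ is finitely generated.
   Context: For an automorphism $\phi$ of a group $G$, $\mathrm{Fix}\,\phi=\{g\in G\mid \phi(g)=g\}$. A group $G$ has $\mathrm{FGFP_a}$ (the finitely generated fixed subgroup property of automorphisms) if $\mathrm{Fix}\,\phi$ is finitely generated for every $\phi\in\mathrm{Aut}(G)$; such a group is itself finitely generated (take $\phi=\mathrm{id}$). For a finitely generated group $G$ with finite generating set $X$: $\mathrm{rk}(H^1(G;\mathbb{Z}))$ is the torsion-free rank of the abelianization of $G$. The character sphere is $S(G)=(\mathrm{Hom}(G,\mathbb{R})-\{0\})/\mathbb{R}_+$, whose elements are classes $[\chi]=\{r\chi\mid r\in\mathbb{R}_+\}$, with $\mathbb{R}_+$ the positive reals. Let $\Gamma=\Gamma(G,X)$ be the Cayley graph of $G$ with respect to $X$, and let $\Gamma_\chi$ be the subgraph of $\Gamma$ whose vertices are the $g\in G$ with $\chi(g)\geq 0$ and whose edges are those of $\Gamma$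 connecting two such vertices. The BNS-invariant is $\Sigma^1(G)=\{[\chi]\in S(G)\mid \Gamma_\chi\text{ is connected}\}$. A non-trivial homomorphism $\chi:G\to\mathbb{R}$ is discrete if its image is discrete (hence infinite cyclic), and $S\mathbb{Q}(G)=\{[\chi]\in S(G)\mid \chi\text{ is discrete}\}$. *)

(* Defs.v *)
From Stdlib Require Import Relation_Operators.
From HB Require Import structures.
From mathcomp Require Import all_boot all_order all_algebra.
From mathcomp Require Import all_classical all_reals all_analysis.

Set Implicit Arguments.
Unset Strict Implicit.
Unset Printing Implicit Defensive.

Import Order.TTheory GRing.Theory Num.Theory.
Import numFieldNormedType.Exports.

Local Open Scope classical_set_scope.
Local Open Scope ring_scope.

(* Abstract groups are [groupType]s. This asks for a choice operator on the
   carrier, which every type has under the classical axioms of [boolp].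
   [to_multiplicative V] is the group underlying the additive group [V]. *)
Notation to_multiplicative := Algebra.to_multiplicative.

Section Subgroups.
Variable G : groupType.

Definition subgroup (H : set G) : Prop :=
  H 1%g /\ forall x y, H x -> H y -> H (x / y)%g.

Definition generated (X : set G) : set G := smallest subgroup X.

Definition fg_subgroup (H : set G) : Prop :=
  exists2 X : set G, finite_set X & generated X = H.

Definition finite_generating_set (X : set G) : Prop :=
  finite_set X /\ generated X = setT.

Definition derived_subgroup : set G :=
  generated [set [~ x, y]%g | x in setT & y in setT].

(* A multiplicative map between groups preserves 1 and inverses, so
   {multiplicative G -> H} is Hom(G, H). *)
Definition automorphism (phi : {multiplicative G -> G}) : Prop :=
  bijective phi.

Definition fixed_subgroup (phi : {multiplicative G -> G}) : set G :=
  [set g | phi g = g].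

Definition FGFPa : Prop :=
  forall phi : {multiplicative G -> G},
    automorphism phi -> fg_subgroup (fixed_subgroup phi).

Definition hom_kernel (H : groupType) (f : {multiplicative G -> H}) : set G :=
  [set g | f g = 1%g].

End Subgroups.

Section Abelianization.
Variable G : groupType.
Local Open Scope group_scope.
Local Open Scope quotient_scope.

Local Notation D := (@derived_subgroup G).

Lemma subgroup_generated (X : set G) : subgroup (generated X).
Proof.
split=> [H [[H1 _] _] //|x y Dx Dy H [sH XH]].
by apply: sH.2; [apply: Dx | apply: Dy].
Qed.

Lemma derived1 : D 1.
Proof. exact: (subgroup_generated _).1. Qed.

Lemma derivedF x y : D x -> D y -> D (x / y).
Proof. exact: (subgroup_generated _).2. Qed.

Lemma derivedV x : D x -> D x^-1.
Proof. by move=> Dx; rewrite -[x^-1]mul1g; exact: derivedF derived1 Dx. Qed.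

Lemma derivedM x y : D x -> D y -> D (x * y).
Proof. by move=> Dx Dy; rewrite -[y]invgK; exact: derivedF Dx (derivedV Dy). Qed.

Lemma derivedR x y : D [~ x, y].
Proof. by move=> H [_]; apply; exists x => //; exists y. Qed.

Lemma derivedJ x y : D x -> D (x ^ y).
Proof.
move=> Dx; rewrite -[x ^ y](mulVKg x) -/([~ x, y]).
exact: derivedM Dx (derivedR _ _).
Qed.

Definition ab_eq : rel G := fun x y => `[< D (x^-1 * y) >].

Lemma ab_eq_refl : reflexive ab_eq.
Proof. by move=> x; apply/asboolP; rewrite mulVg; exact: derived1. Qed.

Lemma ab_eq_sym : symmetric ab_eq.
Proof.
have sub x y : ab_eq x y -> ab_eq y x.
  by move=> /asboolP/derivedV; rewrite invgM invgK => Dyx; exact/asboolP.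
by move=> x y; apply/idP/idP; exact: sub.
Qed.

Lemma ab_eq_trans : transitive ab_eq.
Proof.
move=> y x z /asboolP Dxy /asboolP Dyz; apply/asboolP.
by rewrite -[z](mulVKg y) mulgA; exact: derivedM.
Qed.

Canonical ab_eq_equiv := EquivRel ab_eq ab_eq_refl ab_eq_sym ab_eq_trans.

Definition abelianization := {eq_quot ab_eq}.
HB.instance Definition _ := Choice.on abelianization.
HB.instance Definition _ := EqQuotient.on abelianization.

Definition ab_zero : abelianization := \pi_abelianization 1.
Definition ab_opp (a : abelianization) : abelianization :=
  \pi_abelianization (repr a)^-1.
Definition ab_add (a b : abelianization) : abelianization :=
  \pi_abelianization (repr a * repr b).

Lemma pi_abP x y :
  \pi_abelianization x = \pi_abelianization y <-> D (x^-1 * y).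
Proof. by split => [/eqquotP/asboolP //|Dxy]; exact/eqquotP/asboolP. Qed.

Lemma pi_ab_add x y :
  \pi_abelianization (x * y) =
  ab_add (\pi_abelianization x) (\pi_abelianization y).
Proof.
rewrite /ab_add; apply/pi_abP.
case: (piP abelianization x) => x' /pi_abP Dx.
case: (piP abelianization y) => y' /pi_abP Dy.
have -> : (x * y)^-1 * (x' * y') = (x^-1 * x') ^ y * (y^-1 * y').
  by rewrite /conjg invgM !mulgA mulgK.
apply: derivedM => //; exact: derivedJ.
Qed.

Lemma ab_addA : associative ab_add.
Proof.
elim/quotW=> x; elim/quotW=> y; elim/quotW=> z.
by rewrite -(pi_ab_add y z) -(pi_ab_add x y) -!pi_ab_add mulgA.
Qed.

Lemma ab_addC : commutative ab_add.
Proof.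
elim/quotW=> x; elim/quotW=> y.
rewrite -(pi_ab_add x y) -(pi_ab_add y x); apply/pi_abP.
rewrite (_ : _ * _ = [~ y, x]); first exact: derivedR.
by rewrite /commg /conjg invgM !mulgA.
Qed.

Lemma ab_add0 : left_id ab_zero ab_add.
Proof. by elim/quotW=> x; rewrite -(pi_ab_add 1 x) mul1g. Qed.

Lemma ab_addN : left_inverse ab_zero ab_opp ab_add.
Proof.
elim/quotW=> x; rewrite /ab_opp; set y := repr _.
rewrite -[in X in ab_add _ X](reprK (\pi_abelianization x)).
by rewrite -(pi_ab_add y^-1 y) mulVg.
Qed.

HB.instance Definition _ :=
  GRing.isZmodule.Build abelianization ab_addA ab_addC ab_add0 ab_addN.

End Abelianization.

Section Rank.

Definition Z_independent (A : zmodType) (k : nat) (a : 'I_k -> A) : Prop :=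
  forall c : 'I_k -> int, \sum_i a i *~ c i = 0 -> forall i, c i = 0.

(* An extended real, as the rank may be infinite. *)
Definition torsion_free_rank (R : realType) (A : zmodType) : \bar R :=
  ereal_sup [set (k%:R)%:E | k in
    [set k : nat | exists a : 'I_k -> A, Z_independent a]].

Definition rk_H1 (R : realType) (G : groupType) : \bar R :=
  torsion_free_rank R (abelianization G).

End Rank.

Section BNS.
Variables (R : realType) (G : groupType).

Definition realhom : Type := {multiplicative G -> to_multiplicative R}.

Implicit Type chi : realhom.

Definition nontrivial chi : Prop := exists g, chi g <> 0 :> R.

Definition char_class chi : set realhom :=
  [set psi : realhom |
    exists2 r : R, 0 < r & forall g, psi g = r * (chi g : R) :> R].

Definition char_sphere : set (set realhom) :=
  [set char_class chi | chi in nontrivial].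

Definition Cayley_edge (X : set G) (g h : G) : Prop :=
  exists2 x, X x & h = (g * x)%g.

Definition half_space chi : set G := [set g | 0 <= (chi g : R)].

Definition half_edge (X : set G) chi (g h : G) : Prop :=
  [/\ half_space chi g, half_space chi h & Cayley_edge X g h].

(* Paths may run along the edges in both directions. *)
Definition half_graph_connected (X : set G) chi : Prop :=
  forall g h, half_space chi g -> half_space chi h ->
    clos_refl_sym_trans G (half_edge X chi) g h.

Definition Sigma1 (X : set G) : set (set realhom) :=
  [set char_class chi | chi in
    [set chi | nontrivial chi /\ half_graph_connected X chi]].

Definition discrete_char chi : Prop :=
  nontrivial chi /\ range (chi : G -> R) `<=` isolated (range (chi : G -> R)).

Definition rational_sphere : set (set realhom) :=
  [set char_class chi | chi in discrete_char].

End BNS.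

Arguments FGFPa G : clear implicits.
Arguments derived_subgroup G : clear implicits.
Arguments char_sphere R G : clear implicits.
Arguments rational_sphere R G : clear implicits.
Arguments Sigma1 R {G} X.

(* Main.v *)
From Stdlib Require Import Relation_Operators.
From HB Require Import structures.
Require Import Defs.
From mathcomp Require Import all_boot all_order all_algebra.
From mathcomp Require Import all_classical all_reals all_analysis.
From mathcomp Require Import ring lra zify.

Set Implicit Arguments.
Unset Strict Implicit.
Unset Printing Implicit Defensive.

Import Order.TTheory GRing.Theory Num.Theory.
Import numFieldNormedType.Exports.

Local Open Scope classical_set_scope.
Local Open Scope ring_scope.

(** Two kinds of automorphisms of [G * A], for [A = Z^n], carry the fixed-point
    hypotheses. The product of an automorphism [phi] of [G] with [-1] on [A] has
    the fixed points of [phi], so the property descends from [G * A] to [G]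
    ([FGFPa_prodl]). The shear [(g, a) |-> (g, a + beta g)] along a homomorphism
    [beta : G -> A] fixes [ker beta * A], so [ker beta] is finitely generated
    ([fg_hom_kernel_of_FGFPa]).

    The link with [Sigma^1] is a theorem of Bieri, Neumann and Strebel: in a
    finitely generated group, a subgroup [N] containing the derived subgroup is
    finitely generated iff the half graph of every nontrivial character
    vanishing on [N] is connected.

    If [N] is finitely generated and [chi t > 0] ([half_graph_connected_of_fg]),
    a vertex [g] of the half space is joined to [1] by first climbing to a high
    power [t ^ K]; the paths labelled by [g] and by a commutator in [N], which
    lead from [t ^ K] to [g * t ^ K], then never leave the half space.

    Conversely ([fg_of_half_graphs_connected]), let [beta : G -> Z^k] kill [N],
    with finite fibers modulo [N]. Connectedness of the half graph of a
    character [chi] provides, between any two edges at a vertex that do not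
    lower [chi], a detour on which [chi] is strictly positive. Compactness of
    the unit sphere of characters makes finitely many such detours suffice, with
    uniform bounds ([uniform_detour]). Hence in a path of the Cayley graph any
    vertex whose image in [R^k] is far from the origin can be replaced by
    vertices closer to the origin ([push_vertex]), and every element of [N] is
    reached by a path whose image stays in a fixed ball. This ball meets
    finitely many cosets of [N], and the argument of Schreier's lemma gives a
    finite generating set.

    For the first part of the theorem, [N] is the kernel of a homomorphism to
    [Z], a discrete character being a real multiple of such a homomorphism
    ([discrete_char_multiple]). For the second part, [beta] consists of the
    coordinates of the abelianization on a maximal independent family, of size
    [k <= m] by the bound on the rank. Elements of [ker beta] have a power in
    the derived subgroup, hence all characters vanish on [ker beta], and the
    shear by [beta] makes it finitely generated. *)

(** * Homomorphisms and finitely generated subgroups *)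

Definition multiplicative_of (G H : groupType) (f : G -> H)
    (fM : {morph f : x y / (x * y)%g}) : {multiplicative G -> H} :=
  HB.pack f (isMultiplicative.Build G H f fM).

Section GroupHomomorphism.
Variables (G H : groupType) (f : {multiplicative G -> H}).

Lemma mulg_hom1 : f 1%g = 1%g.
Proof. by apply: (mulgI (f 1%g)); rewrite -gmulfM !mulg1. Qed.

Lemma mulg_homV : {morph f : x / x^-1%g}.
Proof.
move=> x; apply: (mulgI (f x)); rewrite -gmulfM !mulgV; exact: mulg_hom1.
Qed.

Lemma mulg_homF : {morph f : x y / (x / y)%g}.
Proof. by move=> x y; rewrite gmulfM mulg_homV. Qed.

End GroupHomomorphism.

Section Generation.
Variable G : groupType.
Implicit Types (X H : set G) (x y : G).

Lemma subgroupV H x : subgroup H -> H x -> H x^-1%g.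
Proof. by case=> H1 HF Hx; rewrite -[x^-1%g]mul1g; exact: HF. Qed.

Lemma subgroupM H x y : subgroup H -> H x -> H y -> H (x * y)%g.
Proof.
by move=> sH Hx Hy; rewrite -[y]invgK; apply: sH.2 => //; exact: subgroupV.
Qed.

Lemma sub_generated X : X `<=` generated X.
Proof. exact: sub_gen_smallest. Qed.

Lemma generated_min X H : subgroup H -> X `<=` H -> generated X `<=` H.
Proof. by move=> sH XH; exact: smallest_sub. Qed.

End Generation.

Lemma fg_subgroup_image (G H : groupType) (f : {multiplicative G -> H})
    (K : set G) :
  fg_subgroup K -> fg_subgroup (f @` K).
Proof.
case=> X finX <-; exists (f @` X); first exact: finite_image.
have sgen := subgroup_generated (f @` X).
rewrite eqEsubset; split.
  apply: generated_min; last by apply: image_subset; exact: sub_generated.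
  have [g1 gF] := subgroup_generated X; split.
    by exists 1%g; [exact: g1 | exact: mulg_hom1].
  move=> _ _ [x Kx <-] [y Ky <-]; exists (x / y)%g; last exact: mulg_homF.
  exact: gF.
move=> _ [x Kx <-].
apply: (@generated_min _ X (f @^-1` generated (f @` X))) Kx => [|y Xy /=].
  split=> [|y z] /=; first by rewrite mulg_hom1; exact: sgen.1.
  by rewrite mulg_homF; exact: sgen.2.
by apply: sub_generated; exists y.
Qed.

(** * Real characters *)

Section RealCharacters.
Variables (R : realType) (G : groupType).
Implicit Types (chi : realhom R G) (g h : G).

Lemma charM chi g h : chi (g * h)%g = (chi g : R) + (chi h : R) :> R.
Proof. exact: (gmulfM (s := chi) g h). Qed.

Lemma char1 chi : chi 1%g = 0 :> R.
Proof. exact: (mulg_hom1 chi). Qed.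

Lemma charV chi g : chi g^-1%g = - (chi g : R) :> R.
Proof. exact: (mulg_homV chi g). Qed.

Lemma charX chi g n : chi (g ^+ n)%g = (chi g : R) *+ n :> R.
Proof.
elim: n => [|n IHn]; first exact: char1.
by rewrite expgS charM IHn mulrS.
Qed.

Lemma char_ker_subgroup chi : subgroup [set g | chi g = 0 :> R].
Proof.
split=> [|x y /= x0 y0]; first exact: char1.
by rewrite charM charV x0 y0 oppr0 addr0.
Qed.

Lemma derived_sub_char_ker chi :
  derived_subgroup G `<=` [set g | chi g = 0 :> R].
Proof.
apply: generated_min; first exact: char_ker_subgroup.
move=> _ [x _ [y _ <-]] /=; rewrite /commg /conjg !charM !charV.
ring.
Qed.

Lemma char_neq0_generator (X : set G) chi :
  generated X = setT -> nontrivial chi -> exists2 x, X x & chi x <> 0 :> R.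
Proof.
move=> genX [g chig]; apply: contrapT => H; apply: chig.
have : generated X g by rewrite genX.
apply: (generated_min (char_ker_subgroup chi)) => x Xx /=.
by apply: contrapT => chix; apply: H; exists x.
Qed.

(** Membership of a class does not depend on the representative, because
    rescaling by a positive real does not change the half space. *)
Lemma Sigma1P (X : set G) chi :
  Sigma1 R X (char_class chi) <-> nontrivial chi /\ half_graph_connected X chi.
Proof.
split=> [[psi [ntpsi cpsi] E]|]; last by move=> H; exists chi.
have : char_class chi chi by exists 1 => // g; rewrite mul1r.
rewrite -E => -[r r0 chiE].
have hsE g : half_space chi g <-> half_space psi g.
  by rewrite /half_space /= chiE pmulr_rge0.
split.
  have [g psig] := ntpsi; exists g; rewrite chiE => /eqP.
  by rewrite mulf_eq0 gt_eqF //= => /eqP.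
move=> g h /hsE hg /hsE hh; have := cpsi g h hg hh.
elim=> [x y [/hsE Hx /hsE Hy Hxy]|x|x y _ IH|x y z _ IH1 _ IH2].
- by apply: rst_step.
- exact: rst_refl.
- exact: rst_sym.
- exact: rst_trans IH1 IH2.
Qed.

End RealCharacters.

(** * From a finitely generated kernel to connected half graphs *)

Section KernelToHalfGraph.
Variables (R : realType) (G : groupType) (X : set G) (chi : realhom R G).
Local Notation conn := (clos_refl_sym_trans G (half_edge X chi)).

(** A word for [g] has finitely many prefixes, so the path it labels stays in
    the half space when it starts high enough. *)
Lemma conn_mulr_far (g : G) : generated X g ->
  exists D : R, forall h, D <= (chi h : R) -> conn h (h * g)%g.
Proof.
move: g; apply: generated_min; last first.
  move=> x Xx; exists (Num.max 0 (- (chi x : R))) => h.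
  rewrite ge_max => /andP[h0 hx]; apply: rst_step; split => //.
    by rewrite /half_space /= charM -lerBlDr sub0r.
  by exists x.
split; first by exists 0 => h _; rewrite mulg1; exact: rst_refl.
move=> x y [Dx Hx] [Dy Hy].
exists (Num.max Dx (Dy - (chi x : R) + (chi y : R))) => h.
rewrite ge_max => /andP[/Hx chx hy]; apply: rst_trans chx _.
have := Hy (h * (x / y))%g; rewrite -!mulgA mulVg mulg1 => H.
apply: rst_sym; apply: H.
by rewrite !charM charV; lra.
Qed.

(** Since [chi] vanishes on [N], a product of generators of [N] returns to the
    starting height after each factor: the bound for the generators serves for
    all of [N]. *)
Lemma conn_mulr_fg_far (N : set G) :
    generated X = setT -> fg_subgroup N -> N `<=` [set g | chi g = 0 :> R] ->
  exists D : R, forall n h, N n -> D <= (chi h : R) -> conn h (h * n)%g.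
Proof.
move=> genX [F /finite_seqP[s ->] <-] Nker.
have [D HD] : exists D : R, forall n h, n \in s -> D <= (chi h : R) ->
    conn h (h * n)%g.
  elim: s {Nker} => [|a s [D HD]]; first by exists 0.
  have [|Da Ha] := @conn_mulr_far a; first by rewrite genX.
  exists (Num.max Da D) => n h; rewrite inE ge_max => /predU1P[->|ns] /andP[];
    by [move=> /Ha | move=> _ /HD; exact].
exists D => n h Nn.
have : generated [set` s] `<=` [set n | chi n = 0 :> R /\
    forall h, D <= (chi h : R) -> conn h (h * n)%g].
  apply: generated_min; last first.
    by move=> m sm; split=> [|k]; [apply: Nker; exact: sub_generated | exact: HD].
  split.
    by split=> [|k _]; rewrite ?mulg1; [exact: char1 | exact: rst_refl].
  move=> x y [x0 Hx] [y0 Hy]; split=> [|k Dk].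
    by apply: (char_ker_subgroup chi).2.
  apply: rst_trans (Hx _ Dk) _; apply: rst_sym.
  have := Hy (k * (x / y))%g; rewrite -!mulgA mulVg mulg1; apply.
  by rewrite !charM charV x0 y0; lra.
by move=> /(_ _ Nn)[_]; apply.
Qed.

(** Let [t] be an edge label on which [chi] is positive. A vertex [g] of the
    half space is joined to [1] through [t ^ K] and [t ^ K * g = g * t ^ K * n],
    where [n] is a commutator: for [K] large the two long paths, labelled by
    [g] and by [n], stay in the half space. *)
Lemma half_graph_connected_of_fg (N : set G) :
    generated X = setT -> fg_subgroup N -> derived_subgroup G `<=` N ->
    N `<=` [set g | chi g = 0 :> R] -> nontrivial chi ->
  half_graph_connected X chi.
Proof.
move=> genX fgN DN Nker ntchi.
have [t chit stept] : exists2 t, 0 < (chi t : R) & forall h : G,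
    half_space chi h -> conn h (h * t)%g.
  have [x Xx chix] := char_neq0_generator genX ntchi.
  have /orP[x0|x0] : (0 < (chi x : R)) || ((chi x : R) < 0).
    by rewrite orbC -neq_lt; apply/eqP.
  - exists x => // h h0; apply: rst_step; split => //; last by exists x.
    by rewrite /half_space /= charM addr_ge0 // ltW.
  - exists x^-1%g => [|h h0]; first by rewrite charV oppr_gt0.
    apply: rst_sym; apply: rst_step; split => //.
      2: by exists x; rewrite ?mulgVK.
    by rewrite /half_space /= charM charV; rewrite /half_space /= in h0; lra.
have stepX h k : half_space chi h -> conn h (h * t ^+ k)%g.
  move=> h0; elim: k => [|k IHk]; first by rewrite mulg1; exact: rst_refl.
  apply: rst_trans IHk _; rewrite expgSr mulgA; apply: stept.
  by rewrite /half_space /= charM charX addr_ge0 // mulrn_wge0 // ltW.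
suff to1 g : half_space chi g -> conn 1%g g.
  by move=> g h /to1 H /to1; apply: rst_trans; exact: rst_sym.
move=> g0.
have [D HD] := conn_mulr_fg_far genX fgN Nker.
have [|Dg Hg] := @conn_mulr_far g; first by rewrite genX.
have [k Hk] : exists k : nat, Num.max D Dg <= (chi (t ^+ k)%g : R).
  exists (Num.truncn (Num.max D Dg / (chi t : R))).+1.
  rewrite charX -mulr_natl -ler_pdivrMr //; apply: ltW; exact: truncnS_gt.
move: Hk; rewrite ge_max => /andP[kD kDg].
have N1 : N [~ t ^+ k, g]%g by apply: DN; exact: derivedR.
have := stepX 1%g k; rewrite mul1g => H.
apply: rst_trans; first by apply: H; rewrite /half_space /= char1.
apply: rst_trans (Hg _ kDg) _.
have -> : (t ^+ k * g = (g * t ^+ k) * [~ t ^+ k, g])%g.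
  by rewrite /commg /conjg !mulgA mulgK mulgV mul1g.
apply: rst_trans; last by apply: rst_sym; exact: stepX.
apply: rst_sym; apply: HD => //.
by rewrite charM; rewrite /half_space /= in g0; lra.
Qed.

End KernelToHalfGraph.

(** * From connected half graphs to a finitely generated kernel *)

Lemma near_all (T : Type) (I : eqType) (F : set_system T) {FF : Filter F}
    (r : seq I) (P : I -> T -> Prop) :
  (forall i, i \in r -> \near F, P i F) ->
  \near F, {in r, forall i, P i F}.
Proof.
elim: r => [|i r IHr] H; first by apply: filterE.
have Pi : \near F, P i F by apply: H; rewrite inE eqxx.
have {}IHr : \near F, {in r, forall j, P j F}.
  by apply: IHr => j jr; apply: H; rewrite inE jr orbT.
by apply: filterS2 Pi IHr => t Pit Prt j; rewrite inE => /predU1P[->|/Prt].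
Qed.

Section HalfGraphToKernel.
Variables (R : realType) (G : groupType).
Variables (k : nat) (beta : G -> 'rV[int]_k).
Hypothesis betaM : forall x y, beta (x * y)%g = beta x + beta y.

Fact lin_charM (u : 'rV[R]_k) :
  {morph (fun g => \sum_j u 0 j * (beta g 0 j)%:~R : to_multiplicative R) :
    x y / (x * y)%g}.
Proof.
move=> x y; rewrite -[RHS]big_split /=; apply: eq_bigr => j _.
by rewrite betaM mxE intrD mulrDr.
Qed.

Definition lin_char (u : 'rV[R]_k) : realhom R G :=
  multiplicative_of (lin_charM u).

Lemma lin_charE u g : lin_char u g = \sum_j u 0 j * (beta g 0 j)%:~R :> R.
Proof. by []. Qed.

Lemma lin_char_continuous g : continuous (fun u => lin_char u g : R).
Proof.
apply: (@continuous_big R _ +%R 0 xpredT) => [|j _ u].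
  exact: add_continuous.
apply: (@cvgMr_tmp _ _ (nbhs u)); exact: coord_continuous.
Qed.

Variable s : seq G.
Let S := s ++ [seq x^-1%g | x <- s].

Definition Cayley_adj : rel G := fun g h => (g^-1 * h)%g \in S.

Lemma mem_symV x : x \in S -> x^-1%g \in S.
Proof.
rewrite !mem_cat => /orP[xs|/mapP[y ys ->]]; last by rewrite invgK ys.
by apply/orP; right; apply/mapP; exists x.
Qed.

Lemma Cayley_adj_sym : symmetric Cayley_adj.
Proof.
suff H g h : Cayley_adj g h -> Cayley_adj h g.
  by move=> g h; apply/idP/idP; exact: H.
by rewrite /Cayley_adj => /mem_symV; rewrite invgM invgK.
Qed.

Lemma Cayley_adj_mull c g h : Cayley_adj (c * g)%g (c * h)%g = Cayley_adj g h.
Proof. by rewrite /Cayley_adj invgM -mulgA mulKg. Qed.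

Lemma path_mull c g p :
  path Cayley_adj (c * g)%g [seq c * z | z <- p]%g = path Cayley_adj g p.
Proof.
by rewrite path_map; apply: eq_path => x y /=; exact: Cayley_adj_mull.
Qed.

Section Detours.
Variable chi : realhom R G.
Hypothesis ntchi : nontrivial chi.
Hypothesis genS : generated [set` s] = setT.
Hypothesis conn_chi : half_graph_connected [set` s] chi.

Lemma path_of_conn a b :
    clos_refl_sym_trans G (half_edge [set` s] chi) a b -> half_space chi a ->
  exists p, [/\ path Cayley_adj a p, last a p = b &
                {in a :: p, forall z, half_space chi z}].
Proof.
(* Reversing a path requires its starting point to be in the half space too,
   hence the equivalence carried through the induction. *)
move=> ab; suff [_ H] : (half_space chi a <-> half_space chi b) /\
  (half_space chi a -> exists p, [/\ path Cayley_adj a p, last a p = b &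
     {in a :: p, forall z, half_space chi z}]) by [].
elim: ab => [x y [hx hy [z zs E]]|x|x y _ [hxy IH]|x y z _ [hxy IH1] _ [hyz IH2]].
- split=> // _; exists [:: y]; split=> //=.
    by rewrite andbT /Cayley_adj E mulKg mem_cat zs.
  by move=> w; rewrite !inE => /orP[]/eqP->.
- by split=> // hx; exists [::]; split => // w; rewrite inE => /eqP->.
- split=> [|hy]; first by split => /hxy.
  have [p [xp <- Hp]] := IH (hxy.2 hy).
  exists (rev (belast x p)); split.
  + rewrite rev_path (eq_path (e' := Cayley_adj)) // => g h.
    exact: Cayley_adj_sym.
  + by case: p {xp Hp} => //= c p; rewrite rev_cons last_rcons.
  + move=> z zp; apply: Hp.
    by move: zp; rewrite -rev_rcons mem_rev -lastI.
- split=> [|hx]; first by rewrite hxy.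
  have [p [xp yE Hp]] := IH1 hx.
  have [q [yq zE Hq]] := IH2 (hxy.1 hx).
  exists (p ++ q); split.
  + by rewrite cat_path xp yE.
  + by rewrite last_cat yE.
  + move=> w; rewrite -cat_cons mem_cat => /orP[/Hp//|wq].
    by apply: Hq; rewrite inE wq orbT.
Qed.

(** The half graph is translated by the lower of the two end points. *)
Lemma high_path a b : exists p, [/\ path Cayley_adj a p, last a p = b &
  {in a :: p, forall z, Num.min (chi a : R) (chi b) <= (chi z : R)}].
Proof.
have [c cE] : exists c, chi c = Num.min (chi a : R) (chi b) :> R.
  by case: leP => _; [exists a | exists b].
have ha : half_space chi (c^-1 * a)%g.
  by rewrite /half_space /= charM charV cE addrC subr_ge0 ge_min lexx.
have hb : half_space chi (c^-1 * b)%g.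
  by rewrite /half_space /= charM charV cE addrC subr_ge0 ge_min lexx orbT.
have [p [ap bE Hp]] := path_of_conn (conn_chi ha hb) ha.
exists [seq c * z | z <- p]%g; split.
- by rewrite -[a in path _ a](mulVKg c) path_mull.
- by rewrite -[a in last a _](mulVKg c) last_map bE mulVKg.
move=> z zp; rewrite -cE.
have : (c^-1 * z)%g \in (c^-1 * a)%g :: p.
  move: zp; rewrite -[a in a :: _](mulVKg c) -(map_cons ( *%g c)).
  by case/mapP=> w wp ->; rewrite mulKg.
by move=> /Hp; rewrite /half_space /= charM charV addrC subr_ge0.
Qed.

(** The path from [x] first follows an edge [t] uphill, then a high path from
    [x * t] to [y * t], and finally the same edge downhill. *)
Lemma positive_detour x y : 0 <= (chi x : R) -> 0 <= (chi y : R) ->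
  exists q, path Cayley_adj x (rcons q y) /\ {in q, forall z, 0 < (chi z : R)}.
Proof.
move=> x0 y0.
have [t tS t0] : exists2 t, t \in S & 0 < (chi t : R).
  have [z zs chiz] := char_neq0_generator genS ntchi.
  have /orP[z0|z0] : (0 < (chi z : R)) || ((chi z : R) < 0).
    by rewrite orbC -neq_lt; apply/eqP.
  - by exists z => //; rewrite mem_cat (zs : z \in s).
  - exists z^-1%g; last by rewrite charV oppr_gt0.
    by apply: mem_symV; rewrite mem_cat (zs : z \in s).
have [p [xp yE Hp]] := high_path (x * t)%g (y * t)%g.
exists ((x * t)%g :: p); split.
  rewrite /= rcons_path xp yE /Cayley_adj mulKg tS /= invgM -mulgA mulVg mulg1.
  exact: mem_symV.
move=> z /Hp; apply: lt_le_trans.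
by rewrite lt_min !charM !ltr_wpDl.
Qed.

End Detours.

Definition beta_sqnorm (g : G) : int := \sum_j (beta g 0 j) ^+ 2.

(** The bound [n] serves both as an upper bound for lengths and, through its
    inverse, as a positive lower bound for the values of the character, which
    makes the property monotone in [n]. *)
Definition has_detour (n : nat) (u : 'rV[R]_k) x y :=
  exists q, path Cayley_adj x (rcons q y) /\
    {in q, forall z, 1 <= (lin_char u z : R) * n%:R /\ beta_sqnorm z <= n%:Z}.

Definition uniform_detours (n : nat) := forall (u : 'rV[R]_k) x y, `|u| = 1 ->
  x \in S -> y \in S ->
  0 <= (lin_char u x : R) -> 0 <= (lin_char u y : R) -> has_detour n u x y.

Hypothesis genS : generated [set` s] = setT.
Hypothesis conn_lin : forall u : 'rV[R]_k, u != 0 ->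
  nontrivial (lin_char u) /\ half_graph_connected [set` s] (lin_char u).

(** A detour that is strictly positive for [u0] stays bounded below, with
    uniform constants, for the characters close to [u0]. If [x] or [y] is
    negative for [u0], it is negative nearby. *)
Lemma near_has_detour (u0 : 'rV[R]_k) x y : u0 != 0 ->
  \forall u \near u0 & n \near \oo,
    0 <= (lin_char u x : R) -> 0 <= (lin_char u y : R) -> has_detour n u x y.
Proof.
move=> /conn_lin[nt0 conn0].
have near_lt z c : (lin_char u0 z : R) < c ->
    \forall u \near u0, (lin_char u z : R) < c.
  exact: (cvgr_lt _ (@lin_char_continuous z u0)).
have near_gt z c : c < (lin_char u0 z : R) ->
    \forall u \near u0, c < (lin_char u z : R).
  exact: (cvgr_gt _ (@lin_char_continuous z u0)).
have [x0|x0] := ltP (lin_char u0 x : R) 0.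
  near=> u n => /=; rewrite leNgt => /negP[]; near: u; exact: near_lt.
have [y0|y0] := ltP (lin_char u0 y : R) 0.
  near=> u n => /= _; rewrite leNgt => /negP[]; near: u; exact: near_lt.
have [q [xy Hq]] := positive_detour nt0 genS conn0 x0 y0.
have Hu : \forall u \near u0, {in q, forall z,
    (lin_char u0 z : R) / 2 < (lin_char u z : R)}.
  apply: (near_all (F := nbhs u0)) => z /Hq z0; apply: near_gt; lra.
have Hn : \forall n \near \oo, {in q, forall z,
    2 <= (lin_char u0 z : R) * n%:R /\ beta_sqnorm z <= n%:Z}.
  apply: (near_all (F := \oo)) => z /Hq z0.
  have H1 := nbhs_infty_ger (2 / (lin_char u0 z : R)).
  have H2 := nbhs_infty_ge `|beta_sqnorm z|%N.
  near=> n; split.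
    rewrite mulrC -ler_pdivrMr //; near: n; exact: H1.
  rewrite (le_trans (ler_norm _)) // -abszE lez_nat; near: n; exact: H2.
near=> u n => /= _ _; exists q; split=> // z zq.
have /(_ _ zq) Hzu : {in q, forall z,
    (lin_char u0 z : R) / 2 < (lin_char u z : R)}.
  by near: u.
have /(_ _ zq)[Hzn ?] : {in q, forall z,
    2 <= (lin_char u0 z : R) * n%:R /\ beta_sqnorm z <= n%:Z}.
  by near: n.
split=> //; have n0 : 0 <= n%:R :> R by exact: ler0n.
have := ler_wpM2r n0 (ltW Hzu); lra.
Unshelve. all: by end_near. Qed.

(** Compactness of the sphere turns the local bounds into one bound. *)
Lemma uniform_detour : exists n, uniform_detours n.
Proof.
pose K := [set u : 'rV[R]_k | `|u| = 1].
have cptK : compact K.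
  apply: bounded_closed_compact.
    by exists 1; split => // M M1 u /= ->; exact: ltW.
  apply: (@closed_comp _ _ (fun u : 'rV[R]_k => `|u|) [set 1]) => [u _|].
    exact: norm_continuous.
  exact: closed_eq.
pose P n u := {in S, forall x, {in S, forall y, 0 <= (lin_char u x : R) ->
  0 <= (lin_char u y : R) -> has_detour n u x y}}.
have : \forall n \near \oo, K `<=` P n.
  apply: (compact_near_coveringP K).1 => // u0 u01.
  have u00 : u0 != 0 by rewrite -normr_gt0 u01.
  apply: (near_all (F := filter_prod (nbhs u0) \oo)) => x xS.
  apply: (near_all (F := filter_prod (nbhs u0) \oo)) => y yS.
  exact: near_has_detour.
case=> n _ /(_ n (leqnn n)) H; exists n => u x y u1 xS yS; exact: H.
Qed.

Lemma beta_sqnormM g h :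
  beta_sqnorm (g * h)%g =
  beta_sqnorm g + 2 * (\sum_j beta g 0 j * beta h 0 j) + beta_sqnorm h.
Proof.
rewrite /beta_sqnorm mulr_sumr -!big_split /=; apply: eq_bigr => j _.
by rewrite betaM mxE; ring.
Qed.

Lemma beta_sqnorm_ge0 g : 0 <= beta_sqnorm g.
Proof. by apply: sumr_ge0 => j _; exact: sqr_ge0. Qed.

(** Let [u] be the unit vector pointing from [beta v] towards the origin, and
    [r] the length of [beta v], both for the sup norm. Then the square of the
    Euclidean length of [beta (v * z)] is that of [beta v], minus
    [2 * r * lin_char u z], plus that of [beta z]. The neighbors [a] and [b] of
    [v], being no longer than [v], thus lie on edges that do not lower
    [lin_char u], and along the detour between them the linear term wins when
    [r] is large. *)
Lemma push_vertex n : uniform_detours n ->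
  forall v a b, (k * n ^ 4)%N%:Z < beta_sqnorm v ->
    Cayley_adj a v -> Cayley_adj v b ->
    beta_sqnorm a <= beta_sqnorm v -> beta_sqnorm b <= beta_sqnorm v ->
  exists q, path Cayley_adj a (rcons q b) /\
    {in q, forall z, beta_sqnorm z < beta_sqnorm v}.
Proof.
move=> Hn v a b v_far av vb a_le b_le.
pose w : 'rV[R]_k := map_mx intr (beta v); pose r := `|w|.
have wr j : `|(beta v 0 j)%:~R : R| <= r.
  have -> : (beta v 0 j)%:~R = w 0 j by rewrite mxE.
  rewrite /r [leRHS]/Num.norm /= mx_normrE.
  by apply: (@le_bigmax _ _ _ 0 (fun ij : 'I_1 * 'I_k => `|w ij.1 ij.2|) (0, j)).
(* The squared Euclidean length is at most [k * r ^ 2]. *)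
have r_far : (n ^ 2)%:R < r.
  rewrite ltNge; apply/negP => r_le; move: v_far; apply/negP; rewrite -leNgt.
  rewrite -(ler_int R) /beta_sqnorm rmorph_sum /=.
  apply: (@le_trans _ _ (\sum_(j < k) (n ^ 4)%:R)); last first.
    by rewrite sumr_const card_ord -mulrnA mulnC.
  apply: ler_sum => j _; rewrite rmorphXn /= -real_normK ?num_real //.
  rewrite (_ : 4 = 2 * 2)%N // expnM natrX lerXn2r ?nnegrE ?ler0n //.
  exact: le_trans (wr j) r_le.
have r0 : 0 < r by apply: le_lt_trans r_far; exact: ler0n.
pose u := - r^-1 *: w.
have u1 : `|u| = 1.
  by rewrite normrZ normrN normfV (gtr0_norm r0) mulVf // gt_eqF.
have beta_sqnorm_vM z : (beta_sqnorm (v * z)%g)%:~R =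
    (beta_sqnorm v)%:~R - 2 * r * (lin_char u z : R) + (beta_sqnorm z)%:~R :> R.
  rewrite beta_sqnormM !intrD intrM lin_charE /=; congr (_ + _ + _).
  rewrite rmorph_sum /= !mulr_sumr -sumrN; apply: eq_bigr => j _.
  by rewrite !mxE intrM; field; rewrite gt_eqF.
have char_ge0 z : beta_sqnorm (v * z)%g <= beta_sqnorm v ->
    0 <= (lin_char u z : R).
  rewrite -(ler_int R) beta_sqnorm_vM => H.
  have : 0 <= (beta_sqnorm z)%:~R :> R by rewrite ler0z beta_sqnorm_ge0.
  move=> z0; have : 0 <= 2 * r * (lin_char u z : R) by lra.
  by rewrite pmulr_rge0 // mulr_gt0.
have [||||q [ab Hq]] := Hn u (v^-1 * a)%g (v^-1 * b)%g u1.
- by have := av; rewrite Cayley_adj_sym.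
- exact: vb.
- by apply: char_ge0; rewrite mulVKg.
- by apply: char_ge0; rewrite mulVKg.
exists [seq v * z | z <- q]%g; split.
  have := path_mull v (v^-1 * a)%g (rcons q (v^-1 * b)%g).
  by rewrite mulVKg map_rcons mulVKg => ->.
move=> _ /mapP[z /Hq[z1 zn] ->]; rewrite -(ltr_int R) beta_sqnorm_vM.
have n0 : 0 < n%:R :> R.
  by rewrite ltr0n lt0n; apply/negP => /eqP n0; move: z1; rewrite n0 mulr0 ler10.
have : (beta_sqnorm z)%:~R <= n%:R :> R by rewrite -[n%:R]/(n%:Z%:~R) ler_int.
suff : n%:R < 2 * r * (lin_char u z : R) by lra.
have nn : n%:R * n%:R < r by rewrite -natrM mulnn.
have r_le : 2 * r <= 2 * r * ((lin_char u z : R) * n%:R).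
  by rewrite ler_peMr // mulr_ge0 // ltW.
by rewrite -(ltr_pM2r n0); lra.
Qed.

Lemma beta_sqnorm0 g : beta g = 0 -> beta_sqnorm g = 0.
Proof.
by move=> b0; rewrite /beta_sqnorm big1 // => j _; rewrite b0 mxE expr0n.
Qed.

(** Each push replaces one vertex of maximal length by shorter ones, so the
    number of vertices of maximal length decreases. *)
Lemma lower_path n (M : int) h : uniform_detours n ->
  (k * n ^ 4)%N%:Z < M -> beta_sqnorm h < M ->
  forall p, path Cayley_adj 1%g p -> last 1%g p = h ->
    {in p, forall z, beta_sqnorm z <= M} ->
  exists p', [/\ path Cayley_adj 1%g p', last 1%g p' = h &
                 {in p', forall z, beta_sqnorm z < M}].
Proof.
move=> Hn M_big hM p; pose top z := beta_sqnorm z == M.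
have sq1 : beta_sqnorm 1%g = 0.
  by apply: beta_sqnorm0; apply: (addrI (beta 1%g)); rewrite -betaM mulg1 addr0.
have [m] := ubnP (count top p); elim: m p => // m IHm p cnt p1 ph pM.
have [/hasP[v vp /eqP topv]|/hasPn ntop] := boolP (has top p); last first.
  exists p; split=> // z zp; rewrite lt_neqAle pM // andbT; exact: ntop.
move: cnt p1 ph pM; case/splitPr: vp => l1 [|b l2] cnt p1 ph pM.
  by move: hM; rewrite -ph last_cat /= topv ltxx.
move: p1; rewrite cat_path /= => /and4P[p1 av vb p2].
have [|||q [ab Hq]] := push_vertex Hn _ av vb; rewrite ?topv //.
- have : last 1%g l1 \in 1%g :: l1 by exact: mem_last.
  rewrite inE => /predU1P[->|H]; last by apply: pM; rewrite mem_cat H.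
  by rewrite sq1 (le_trans _ (ltW M_big)).
- by apply: pM; rewrite mem_cat !inE eqxx !orbT.
have [||||p' Hp'] := IHm (l1 ++ rcons q b ++ l2); last by exists p'.
- move: cnt; rewrite !count_cat /= -cats1 count_cat /= addn0.
  have -> : top v by rewrite /top topv eqxx.
  have -> : count top q = 0%N.
    apply/eqP; rewrite -leqn0 leqNgt -has_count; apply/hasPn => z /Hq.
    by rewrite topv /top => zM; rewrite lt_eqF.
  by rewrite add0n ltnS addnCA add1n.
- by rewrite !cat_path p1 ab last_rcons.
- by move: ph; rewrite !last_cat last_rcons.
- move=> z; rewrite !mem_cat mem_rcons inE -orbA => /or4P[H|/eqP->|/Hq|H].
  + by apply: pM; rewrite mem_cat H.
  + by apply: pM; rewrite mem_cat !inE eqxx !orbT.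
  + by rewrite topv => /ltW.
  + by apply: pM; rewrite mem_cat !inE H !orbT.
Qed.

(** The bound does not depend on [h]: any path to [h] is pushed down, one unit of
    squared length at a time, to the radius beyond which vertices can be pushed. *)
Lemma bounded_path : exists M : nat, forall h, beta h = 0 ->
  exists p, [/\ path Cayley_adj 1%g p, last 1%g p = h &
                {in p, forall z, beta_sqnorm z <= M%:Z}].
Proof.
have [n Hn] := uniform_detour; exists (k * n ^ 4)%N => h /beta_sqnorm0 h0.
pose N0 := (k * n ^ 4)%N.
have [p [p1 ph]] : exists p, path Cayley_adj 1%g p /\ last 1%g p = h.
  have : generated [set` s] h by rewrite genS.
  move: h {h0}; apply: generated_min; last first.
    move=> x xs; exists [:: x]; split=> //=.
    by rewrite andbT /Cayley_adj invg1 mul1g mem_cat xs.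
  split; first by exists [::].
  move=> x y [p [p1 px]] [q [q1 qy]].
  exists (p ++ rev [seq (x / y) * z | z <- belast 1%g q])%g; split.
    rewrite cat_path p1 px -map_rev -[x in path _ x _](mulgVK y) path_mull -qy.
    rewrite rev_path (eq_path (e' := Cayley_adj)) // => g g'.
    exact: Cayley_adj_sym.
  rewrite last_cat px -map_rev -[x in last x _](mulgVK y) last_map -qy.
  by case: (q) => [|c l] /=; rewrite ?rev_cons ?last_rcons mulg1.
have [d pd] : exists d : nat, {in p, forall z, beta_sqnorm z <= (N0 + d)%N%:Z}.
  elim: p {p1 ph} => [|x p [d pd]]; first by exists 0%N.
  exists (`|beta_sqnorm x| + d)%N => z; rewrite inE => /predU1P[->|/pd zd].
    by rewrite !PoszD abszE addrCA -[leLHS]addr0 lerD // ler_norm.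
  by apply: le_trans zd _; rewrite lez_nat leq_add2l leq_addl.
elim: d p p1 ph pd => [|d IHd] p p1 ph pd.
  by exists p; split => // z /pd; rewrite addn0.
have [||p' [p'1 p'h p'd]] := lower_path Hn _ _ p1 ph pd.
- by rewrite ltz_nat -addn1 leq_add2l.
- by rewrite h0 ltz_nat addnS.
apply: (IHd p') => // z /p'd.
by rewrite addnS -addn1 PoszD ltzD1.
Qed.

(** A loop of bounded length based at the origin is rewritten, as in Schreier's
    lemma, as a product of elements [t * x / t'] of [N], where [x] is an edge
    label and [t], [t'] run through the finitely many coset representatives. *)
Theorem fg_of_half_graphs_connected (N : set G) :
    subgroup N -> (forall g, N g -> beta g = 0) ->
    (forall M : nat, exists2 T : set G, finite_set T &
       forall g, beta_sqnorm g <= M%:Z -> exists2 t, T t & N (g / t)%g) ->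
  fg_subgroup N.
Proof.
move=> sN Nbeta finN.
have [M HM] := bounded_path; have [T finT HT] := finN M.
pose tri (z : G * G * G) := (z.1.1 * z.1.2 / z.2)%g.
pose F := (tri @` (T `*` [set` S] `*` T) `|` T) `&` N.
have sF := subgroup_generated F.
have FN : generated F `<=` N by apply: generated_min => // z [].
(* [T] itself is thrown in to start and to close the telescoping product. *)
exists F.
  apply: finite_setIl; rewrite finite_setU; split => //; apply: finite_image.
  by apply: finite_setX => //; apply: finite_setX => //; exact: finite_seq.
rewrite eqEsubset; split=> // h Nh.
have [p [p1 ph pM]] := HM h (Nbeta h Nh).
have [t Tt Ft] : exists2 t, T t & generated F (1%g / t)%g.
  have [|t Tt Nt] := HT 1%g.
    by rewrite beta_sqnorm0 //; apply: Nbeta; exact: sN.1.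
  exists t => //; rewrite div1g; apply: (subgroupV sF).
  apply: sub_generated; split; first by right.
  by rewrite div1g in Nt; rewrite -[t]invgK; exact: (subgroupV sN Nt).
suff [t' Tt' Ft'] : exists2 t', T t' & generated F (h / t')%g.
  rewrite -[h](mulgVK t'); apply: (subgroupM sF) => //; apply: sub_generated.
  split; first by right.
  have -> : t' = ((h / t')^-1 * h)%g by rewrite invgM invgK mulgVK.
  by apply: (subgroupM sN) => //; apply: (subgroupV sN); exact: FN.
rewrite -ph; elim: p (1%g) t Tt Ft p1 pM {ph} => [|y p IHp] x t Tt Ft /=.
  by exists t.
case/andP=> xy yp pM.
have [|t' Tt' Nt'] := HT y; first by apply: pM; rewrite inE eqxx.
apply: (IHp y t') => // [|z zp]; last by apply: pM; rewrite inE zp orbT.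
have E : (y / t' = (x / t) * (t * (x^-1 * y) / t'))%g.
  by rewrite !mulgA mulgVK mulgV mul1g.
rewrite E; apply: (subgroupM sF) => //; apply: sub_generated; split.
  by left; exists (t, (x^-1 * y)%g, t').
have -> : (t * (x^-1 * y) / t' = (x / t)^-1 * (y / t'))%g.
  by rewrite invgM invgK !mulgA.
by apply: (subgroupM sN) => //; apply: (subgroupV sN); exact: FN.
Qed.

End HalfGraphToKernel.

(** * Automorphisms of products with an abelian group *)

Section FixedSubgroupProperty.

(** Fixed subgroups of [H] only have to be images of fixed subgroups of [L]; the
    automorphisms [psi] and [phi] need not be intertwined by [p]. *)
Lemma FGFPa_of_cover (L H : groupType) (p : {multiplicative L -> H}) :
    (forall phi : {multiplicative H -> H}, automorphism phi ->
       exists2 psi : {multiplicative L -> L}, automorphism psi &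
         p @` fixed_subgroup psi = fixed_subgroup phi) ->
  FGFPa L -> FGFPa H.
Proof.
move=> lift fgL phi /lift[psi autpsi <-].
by apply: fg_subgroup_image; exact: fgL.
Qed.

Lemma FGFPa_iso (L H : groupType) (f : {multiplicative L -> H}) :
  bijective f -> FGFPa L -> FGFPa H.
Proof.
case=> g fK gK; have gM : {morph g : x y / (x * y)%g}.
  by move=> x y; rewrite -{1}[x]gK -{1}[y]gK -gmulfM fK.
apply: (@FGFPa_of_cover _ _ f) => phi [phi' phiK phi'K].
have psiM : {morph (g \o phi \o f) : x y / (x * y)%g}.
  by move=> x y /=; rewrite !gmulfM gM.
exists (multiplicative_of psiM).
  by exists (g \o phi' \o f) => x /=; rewrite gK ?phiK ?phi'K fK.
rewrite eqEsubset; split=> [_ [x /= xE <-]|y /= yE].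
  by rewrite /fixed_subgroup /= -[in RHS]xE gK.
by exists (g y); rewrite /= /fixed_subgroup /= gK // yE.
Qed.

(** In the absence of 2-torsion, the product of [phi] with [-1] on [A] has the
    same fixed points as [phi]. *)
Lemma FGFPa_prodl (H : groupType) (A : zmodType) :
    (forall a : A, - a = a -> a = 0) ->
  FGFPa (H * to_multiplicative A)%type -> FGFPa H.
Proof.
move=> A2; apply: (@FGFPa_of_cover _ _ fst) => phi [phi' phiK phi'K].
have psiM : {morph (fun x : H * to_multiplicative A =>
    (phi x.1, - (x.2 : A) : to_multiplicative A)) : x y / (x * y)%g}.
  move=> x y /=; congr (_, _); first exact: gmulfM.
  exact: (opprD (x.2 : A) y.2).
exists (multiplicative_of psiM).
  exists (fun x => (phi' x.1, - (x.2 : A))) => -[h a] /=.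
    by rewrite phiK opprK.
  by rewrite phi'K opprK.
rewrite eqEsubset; split=> [_ [[h a] /= [hE _] <-] //|h hE].
by exists (h, 0) => //; congr (_, _); [exact: hE | exact: oppr0].
Qed.

(** The shear [(g, a) |-> (g, a + beta g)] fixes exactly [ker beta * A]. *)
Lemma fg_hom_kernel_of_FGFPa (G : groupType) (A : zmodType)
    (beta : {multiplicative G -> to_multiplicative A}) :
  FGFPa (G * to_multiplicative A)%type -> fg_subgroup (hom_kernel beta).
Proof.
pose tau (x : G * to_multiplicative A) : G * to_multiplicative A :=
  (x.1, (x.2 : A) + (beta x.1 : A)).
have tauM : {morph tau : x y / (x * y)%g}.
  move=> x y; congr (_, _); rewrite /= gmulfM.
  exact: (addrACA (x.2 : A) y.2 (beta x.1) (beta y.1)).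
have bijtau : bijective tau.
  exists (fun x => (x.1, (x.2 : A) - (beta x.1 : A))) => -[g a]; congr (_, _).
    exact: (addrK (beta g : A) a).
  exact: (subrK (beta g : A) a).
move=> /(_ (multiplicative_of tauM) bijtau) /(fg_subgroup_image fst).
rewrite (_ : _ @` _ = hom_kernel beta) // eqEsubset; split.
  move=> _ [[g a] /= [E] <-]; rewrite /hom_kernel /=.
  by apply: (addrI (a : A)); rewrite [LHS]E; rewrite -[LHS](addr0 (a : A)).
move=> g g0; exists (g, 0) => //; congr (_, _) => /=.
by rewrite add0r.
Qed.

Lemma FGFPa_rV_le (G : groupType) (n m : nat) : (n <= m)%N ->
  FGFPa (G * to_multiplicative 'rV[int]_m)%type ->
  FGFPa (G * to_multiplicative 'rV[int]_n)%type.
Proof.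
move=> /subnKC <-; set d := (m - n)%N => fgm.
apply: (@FGFPa_prodl _ 'rV[int]_d) => [a /eqP|].
  rewrite -subr_eq0 -opprD oppr_eq0 => /eqP a0; apply/rowP => j.
  have /rowP/(_ j) := a0; rewrite !mxE; lra.
pose f (x : G * to_multiplicative 'rV[int]_(n + d)) :
    (G * to_multiplicative 'rV[int]_n) * to_multiplicative 'rV[int]_d :=
  ((x.1, lsubmx (x.2 : 'rV_(n + d))), rsubmx (x.2 : 'rV_(n + d))).
have fM : {morph f : x y / (x * y)%g}.
  move=> x y; congr (_, _, _); exact: linearD.
apply: (@FGFPa_iso _ _ (multiplicative_of fM)) fgm.
exists (fun x => (x.1.1, row_mx (x.1.2 : 'rV_n) (x.2 : 'rV_d))).
  by move=> [g v] /=; congr (_, _); exact: hsubmxK.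
by move=> [[g v] w]; rewrite /f /= row_mxKl row_mxKr.
Qed.

End FixedSubgroupProperty.

(** * Coordinates on the abelianization *)

Section FreeFamily.
Variable A : zmodType.

Definition comb k (q : 'I_k -> A) (c : 'I_k -> int) := \sum_i q i *~ c i.

Lemma combB k (q : 'I_k -> A) c d :
  comb q c - comb q d = comb q (fun i => c i - d i).
Proof. by rewrite /comb -sumrB; apply: eq_bigr => i _; rewrite mulrzBr. Qed.

Lemma combZ k (q : 'I_k -> A) c (z : int) :
  comb q c *~ z = comb q (fun i => c i * z).
Proof. by rewrite /comb mulrz_suml; apply: eq_bigr => i _; rewrite mulrzA. Qed.

Lemma Z_independent_inj k (q : 'I_k -> A) c d :
  Z_independent q -> comb q c = comb q d -> forall i, c i = d i.
Proof.
move=> indq E i; apply/eqP; rewrite -subr_eq0; apply/eqP.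
by apply: (indq (fun i => c i - d i)); rewrite -/(comb _ _) -combB E subrr.
Qed.

(** A generator is added to the family unless one of its nonzero multiples
    already depends on the family. *)
Lemma almost_spanning_family (s : seq A) :
  exists (k : nat) (q : 'I_k -> A) (M : nat), [/\ (0 < M)%N, Z_independent q &
    {in s, forall a, exists c, a *+ M = comb q c}].
Proof.
elim: s => [|x s [k [q [M [M0 indq Hq]]]]].
  by exists 0%N, (fun=> 0), 1%N; split=> // c _ [].
have [[n [c [n0 nc]]]|indx] :=
    pselect (exists (n : int) (c : 'I_k -> int), n != 0 /\ x *~ n = comb q c).
  exists k, q, (`|n| * M)%N; split=> //.
    by rewrite muln_gt0 absz_gt0 n0.
  move=> a; rewrite inE => /predU1P[->|/Hq[d Hd]].
    exists (fun i => c i * (sgz n * M%:Z)); rewrite -combZ -nc -mulrzA.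
    rewrite -[x *+ _]/(x *~ (`|n| * M)%N%:Z) PoszM abszEsg.
    by congr (_ *~ _); ring.
  by exists (fun i => d i * `|n|%:Z); rewrite -combZ -Hd mulnC mulrnA.
pose q' (i : 'I_k.+1) := if unlift ord0 i is Some j then q j else x.
have q'E c : comb q' c = x *~ c ord0 + comb q (fun i => c (lift ord0 i)).
  rewrite /comb big_ord_recl /q' unlift_none; congr (_ + _).
  by apply: eq_bigr => i _; rewrite liftK.
exists k.+1, q', M; split=> // [c|a].
  rewrite -/(comb _ _) q'E => /eqP; rewrite addr_eq0 => /eqP E.
  have c0 : c ord0 = 0.
    apply: contrapT => /eqP c0; apply: indx.
    exists (c ord0), (fun i => c (lift ord0 i) * -1); split=> //.
    by rewrite -combZ mulrN1z.
  have {}E : comb q (fun i => c (lift ord0 i)) = 0.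
    by apply: oppr_inj; rewrite -E c0 mulr0z oppr0.
  move=> i; case: (unliftP ord0 i) => [j ->|->//].
  exact: (indq _ E).
rewrite inE => /predU1P[->|/Hq[c Hc]].
  exists (fun i => if unlift ord0 i is Some j then 0 else M%:Z).
  rewrite q'E unlift_none /comb big1 ?addr0 ?pmulrn // => i _.
  by rewrite liftK mulr0z.
exists (fun i => if unlift ord0 i is Some j then c j else 0).
rewrite q'E unlift_none mulr0z add0r Hc; apply: eq_bigr => i _.
by rewrite liftK.
Qed.

End FreeFamily.

Section FiniteRepresentatives.

Lemma finite_representatives (G : groupType) (L : Type) (N D : set G)
    (lab : G -> L) :
    finite_set (lab @` D) -> (forall g h, lab g = lab h -> N (g / h)%g) ->
  exists2 T : set G, finite_set T &
    forall g, D g -> exists2 t, T t & N (g / t)%g.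
Proof.
move=> finL labN.
pose sec l :=
  if pselect (exists2 g, D g & lab g = l) is left H then sval (cid2 H) else 1%g.
exists (sec @` (lab @` D)); first exact: finite_image.
move=> g Dg; exists (sec (lab g)); first by exists (lab g) => //; exists g.
apply: labN; rewrite /sec; case: pselect => [H|[]]; last by exists g.
by case: cid2.
Qed.

Lemma finite_int_ball k (M : nat) :
  finite_set [set v : 'rV[int]_k | \sum_j v 0 j ^+ 2 <= M%:Z].
Proof.
pose f (c : {ffun 'I_k -> 'I_(2 * M).+1}) : 'rV[int]_k :=
  \row_j ((c j)%:Z - M%:Z).
apply: (@sub_finite_set _ _ (f @` setT)); last exact/finite_image/finite_finset.
move=> v /= vM.
have vj j : `|v 0 j| <= M%:Z.
  have : v 0 j ^+ 2 <= M%:Z.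
    apply: le_trans vM; rewrite (bigD1 j) //= lerDl sumr_ge0 // => i _.
    exact: sqr_ge0.
  apply: le_trans; rewrite -real_normK ?num_real //.
  have [->|v0] := eqVneq `|v 0 j| 0; first by rewrite expr0n.
  rewrite expr2 ler_peMr // -gtz0_ge1 lt_neqAle eq_sym v0 //.
exists [ffun j => inord (absz (v 0 j + M%:Z)%R)] => //.
apply/rowP => j; rewrite mxE ffunE.
have := vj j; rewrite ler_norml => /andP[v1 v2].
rewrite inordK; first by rewrite gez0_abs; lra.
rewrite -ltz_nat gez0_abs; last by lra.
by rewrite (_ : (2 * M).+1%:Z = M%:Z + M%:Z + 1); [lra | lia].
Qed.

End FiniteRepresentatives.

Section AbelianCoordinates.
Variable G : groupType.

Definition pi_ab (g : G) : abelianization G := \pi_(abelianization G)%qT g.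

Lemma pi_abM g h : pi_ab (g * h)%g = pi_ab g + pi_ab h.
Proof. exact: pi_ab_add. Qed.

Lemma pi_ab1 : pi_ab 1%g = 0.
Proof. by []. Qed.

Lemma pi_abF g h : pi_ab (g / h)%g = pi_ab g - pi_ab h.
Proof. by apply/eqP; rewrite eq_sym subr_eq -pi_abM mulgVK. Qed.

Lemma pi_abX g n : pi_ab (g ^+ n)%g = pi_ab g *+ n.
Proof. by elim: n => [|n IHn]; rewrite ?expgS ?pi_abM ?IHn ?mulrS. Qed.

Lemma pi_ab_eq0 g : pi_ab g = 0 <-> derived_subgroup G g.
Proof.
rewrite -pi_ab1; split=> [/esym/pi_abP|Dg]; first by rewrite invg1 mul1g.
by apply/esym/pi_abP; rewrite invg1 mul1g.
Qed.

Lemma pi_ab_surj a : exists g, pi_ab g = a.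
Proof. by exists (repr a); exact: reprK. Qed.

Variable s : seq G.
Hypothesis genS : generated [set` s] = setT.
Let sg (i : 'I_(size s)) := pi_ab (tnth (in_tuple s) i).

Lemma pi_ab_generators g : exists c, pi_ab g = comb sg c.
Proof.
have : generated [set` s] g by rewrite genS.
move: g; apply: generated_min; last first.
  move=> x xs; have /tnthP[i ->] : x \in in_tuple s by [].
  exists (fun j => (j == i)%:Z).
  rewrite /comb (bigD1 i) //= eqxx mulr1z big1 ?addr0 // => j /negPf->.
  by rewrite mulr0z.
split.
  by exists (fun=> 0); rewrite /comb big1.
move=> x y [c xc] [d yd]; exists (fun i => c i - d i).
by rewrite pi_abF xc yd combB.
Qed.

Variables (k M : nat) (q : 'I_k -> abelianization G).
Hypotheses (M_gt0 : (0 < M)%N) (indq : Z_independent q)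
  (spanq : {in map pi_ab s, forall a, exists c, a *+ M = comb q c}).

Lemma span_multiple g : exists c, pi_ab g *+ M = comb q c.
Proof.
have : generated [set` s] g by rewrite genS.
move: g; apply: generated_min; last first.
  by move=> x xs; apply: spanq; exact: map_f.
split.
  by exists (fun=> 0); rewrite pi_ab1 mul0rn /comb big1.
move=> x y [c xc] [d yd]; exists (fun i => c i - d i).
by rewrite pi_abF mulrnBl xc yd combB.
Qed.

(** [M] times the coordinates of the class of [g] in the torsion-free quotient
    of the abelianization, for the rational basis [q]; the factor [M] clears the
    denominators. *)
Definition ab_coord (g : G) : 'rV[int]_k :=
  \row_i sval (cid (span_multiple g)) i.

Lemma ab_coordE g : pi_ab g *+ M = comb q (ab_coord g 0).
Proof.
rewrite {1}(svalP (cid (span_multiple g))); apply: eq_bigr => i _.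
by rewrite mxE.
Qed.

Lemma ab_coord_unique g c :
  pi_ab g *+ M = comb q c -> forall i, ab_coord g 0 i = c i.
Proof. by rewrite ab_coordE => /(Z_independent_inj indq). Qed.

Lemma ab_coordM x y : ab_coord (x * y)%g = ab_coord x + ab_coord y.
Proof.
apply/rowP => i.
apply: (ab_coord_unique (c := fun i => (ab_coord x + ab_coord y) 0 i)).
rewrite pi_abM mulrnDl !ab_coordE /comb -big_split /=.
by apply: eq_bigr => j _; rewrite [in RHS]mxE mulrzDr.
Qed.

Lemma ab_coord_derived g : derived_subgroup G g -> ab_coord g = 0.
Proof.
move=> /pi_ab_eq0 g0; apply/rowP => i.
apply: (ab_coord_unique (c := fun i => (0 : 'rV_k) 0 i)).
by rewrite g0 mul0rn /comb big1 // => j _; rewrite mxE mulr0z.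
Qed.

Lemma ab_coord_family i :
  exists g, forall j, ab_coord g 0 j = if j == i then M%:Z else 0.
Proof.
have [g gq] := pi_ab_surj (q i); exists g.
apply: (ab_coord_unique (c := fun j => if j == i then M%:Z else 0)).
rewrite /comb (bigD1 i) //= eqxx big1 ?addr0 ?gq // => j /negPf->.
by rewrite mulr0z.
Qed.

(** The power [g ^+ M] lies in the derived subgroup. *)
Lemma char_eq0_of_coord (R : realType) (chi : realhom R G) g :
  ab_coord g = 0 -> chi g = 0 :> R.
Proof.
move=> g0; have /pi_ab_eq0/derived_sub_char_ker : pi_ab (g ^+ M)%g = 0.
  by rewrite pi_abX ab_coordE /comb big1 // => i _; rewrite g0 mxE mulr0z.
move=> /(_ R chi) /=; rewrite charX => /eqP; rewrite mulrn_eq0.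
by rewrite eqn0Ngt M_gt0 => /eqP.
Qed.

(** Modulo the span of the family, the class of [g] is determined by the
    remainders modulo [M] of its coordinates on the generators; on the span
    itself [ab_coord] is injective. *)
Lemma finite_ab_coord_fibers (B : nat) :
  exists2 T : set G, finite_set T &
    forall g, \sum_j (ab_coord g 0 j) ^+ 2 <= B%:Z ->
      exists2 t, T t & derived_subgroup G (g / t)%g.
Proof.
pose rem_of (r : {ffun 'I_(size s) -> 'I_M}) := comb sg (fun i => (r i)%:Z).
have dec g : exists r, exists e, pi_ab g = rem_of r + comb q e.
  have [c gc] := pi_ab_generators g.
  have Mz : M%:Z != 0 by rewrite -lt0n.
  have remP i : (`|(c i %% M)%Z| < M)%N.
    by rewrite -ltz_nat gez0_abs ?modz_ge0 // ltz_mod.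
  have [g' g'E] := pi_ab_surj (comb sg (fun i => (c i %/ M)%Z)).
  exists [ffun i => Ordinal (remP i)]; exists (ab_coord g' 0).
  rewrite -ab_coordE g'E gc -[_ *+ M]/(_ *~ M%:Z) combZ /rem_of /comb.
  rewrite -big_split /=.
  apply: eq_bigr => i _; rewrite -mulrzDr ffunE /= gez0_abs ?modz_ge0 //.
  by rewrite addrC -divz_eq.
have [r rP] := choice dec.
apply: (@finite_representatives _ _ _
  [set g | \sum_j (ab_coord g 0 j) ^+ 2 <= B%:Z] (fun g => (ab_coord g, r g))).
  apply: (@sub_finite_set _ _
    ([set v : 'rV[int]_k | \sum_j v 0 j ^+ 2 <= B%:Z] `*`
     [set: {ffun 'I_(size s) -> 'I_M}])).
    by move=> _ [g gB <-].
  by apply: finite_setX; [exact: finite_int_ball | exact: finite_finset].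
move=> g h [gh rgh]; apply/pi_ab_eq0; rewrite pi_abF.
have [e ge] := rP g; have [f hf] := rP h.
have E : pi_ab g - pi_ab h = comb q (fun i => e i - f i).
  by rewrite ge hf rgh opprD addrACA subrr add0r combB.
have E0 : (pi_ab g - pi_ab h) *+ M = 0 by rewrite mulrnBl !ab_coordE gh subrr.
rewrite E /comb big1 // => i _.
have : (e i - f i) * M%:Z = 0.
  apply: (indq (c := fun i => (e i - f i) * M%:Z)).
  by rewrite -/(comb _ _) -combZ -E.
move/eqP; rewrite mulf_eq0 -[M%:Z == 0]/(M == 0%N) eqn0Ngt M_gt0 orbF.
by move=> /eqP ->; rewrite mulr0z.
Qed.

End AbelianCoordinates.

(** * Discrete characters *)

Section DiscreteCharacters.
Variables (R : realType) (G : groupType).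

(** The smallest positive value [r] of [chi] exists because the values are
    separated, and the remainder of any value modulo [r] is again a value. *)
Lemma discrete_char_multiple (chi : realhom R G) : discrete_char chi ->
  exists (alpha : {multiplicative G -> to_multiplicative int}) (r : R),
    0 < r /\ forall g, chi g = r * (alpha g : int)%:~R :> R.
Proof.
case=> -[g0 ntg0] iso.
have [e e0 He] : exists2 e : R,
    0 < e & forall g, `|chi g : R| < e -> chi g = 0 :> R.
  have r0 : range (chi : G -> R) 0 by exists 1%g => //; exact: (char1 chi).
  have [_ [V V0 VE]] := iso _ r0.
  have /nbhs_ballP[e e0 eV] : nbhs (0 : R) V by exact: V0.
  exists e => // g ge; have : (V `&` range (chi : G -> R)) (chi g).
    split; last by exists g.
    by apply: eV; rewrite /ball /= sub0r normrN.
  by rewrite VE.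
pose E := [set x : R | 0 < x /\ exists g, chi g = x :> R].
have E_nonempty : E !=set0.
  have /orP[g0_gt0|g0_lt0] : (0 < (chi g0 : R)) || ((chi g0 : R) < 0).
    by rewrite orbC -neq_lt; apply/eqP.
  - by exists (chi g0); split => //; exists g0.
  - exists (- (chi g0 : R)); split; first by rewrite oppr_gt0.
    by exists g0^-1%g; exact: charV.
have e_lb : lbound E e.
  move=> x [x0 [g gx]]; rewrite leNgt; apply/negP => xe.
  by have := He g; rewrite gx gtr0_norm // => /(_ xe) E0; rewrite E0 ltxx in x0.
have infE : has_inf E by split => //; exists e.
have ler := lb_le_inf E_nonempty e_lb.
have [x [x0 [gx gxE]] x_lt] := inf_adherent e0 infE.
have x_min y : E y -> x <= y.
  move=> [y0 [gy gyE]]; rewrite leNgt; apply/negP => yx.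
  have : inf E <= y by apply: (ge_inf infE.2); split => //; exists gy.
  move=> ley; have := He (gx / gy)%g.
  rewrite charM charV gxE gyE ger0_norm; last by lra.
  by move=> /(_ ltac:(lra)) xy; lra.
have multiple (z : int) : exists h, chi h = x * z%:~R :> R.
  case: z => n; [exists (gx ^+ n)%g | exists (gx ^+ n.+1)^-1%g].
    by rewrite charX gxE -mulr_natr.
  by rewrite charV charX gxE NegzE mulrNz mulrN -mulr_natr.
pose a g : int := Num.floor ((chi g : R) / x).
have aE g : chi g = x * (a g)%:~R :> R.
  have [h hE] := multiple (a g).
  have /andP[a_le a_gt] := floor_itv ((chi g : R) / x).
  rewrite ler_pdivlMr // -/(a g) mulrC in a_le.
  rewrite ltr_pdivrMr // -/(a g) intrD in a_gt.
  apply: le_anti; rewrite a_le andbT leNgt; apply/negP => lt_a.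
  have : x <= (chi (g / h)%g : R).
    apply: x_min; split; last by exists (g / h)%g.
    by rewrite charM charV hE subr_gt0.
  by rewrite charM charV hE; lra.
have aM : {morph (fun g => a g : to_multiplicative int) : g h / (g * h)%g}.
  move=> g h; apply: (intr_inj (R := R)); apply: (mulfI (lt0r_neq0 x0)).
  by rewrite -aE charM !aE -mulrDr -intrD.
by exists (multiplicative_of aM), x.
Qed.

Lemma discrete_char_of_multiple (chi : realhom R G)
    (alpha : {multiplicative G -> to_multiplicative int}) (r : R) :
    r != 0 -> (exists g, alpha g <> 0 :> int) ->
    (forall g, chi g = r * (alpha g : int)%:~R :> R) ->
  discrete_char chi.
Proof.
move=> r0 [g0 ag0] chiE; split.
  exists g0; rewrite chiE => /eqP.
  by rewrite mulf_eq0 (negPf r0) intr_eq0 => /eqP.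
move=> _ [g _ <-]; split; first by rewrite inE; exists g.
exists (ball (chi g : R) `|r|); first by apply: nbhsx_ballx; rewrite normr_gt0.
rewrite eqEsubset; split=> [y [yb [h _ hy]]|_ ->]; last first.
  by split; [apply: ballxx; rewrite normr_gt0 | exists g].
move: yb; rewrite -hy /ball /= !chiE -mulrBr normrM -intrB -intr_norm.
rewrite gtr_pMr ?normr_gt0 // -[1]/(1%:~R) ltr_int.
rewrite -[ltRHS]add0r ltzD1 normr_le0 subr_eq0 => /eqP E.
by rewrite E.
Qed.

End DiscreteCharacters.

(** * Kernels, characters and fixed subgroups *)

Section FixedSubgroupsAndSigma.
Variables (R : realType) (G : groupType).

Lemma hom_kernel_subgroup (H : groupType) (f : {multiplicative G -> H}) :
  subgroup (hom_kernel f).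
Proof.
split=> [|x y]; rewrite /hom_kernel /=; first exact: mulg_hom1.
by move=> x1 y1; rewrite mulg_homF x1 y1 divgg.
Qed.

(** In both directions a discrete character is a nonzero multiple of a
    homomorphism to [Z], with the same kernel. *)
Lemma rational_sphere_Sigma1P (X : set G) : finite_generating_set X ->
  rational_sphere R G `<=` Sigma1 R X <->
  forall alpha : {multiplicative G -> to_multiplicative int},
    fg_subgroup (hom_kernel alpha).
Proof.
move=> [finX genX]; split=> [sub alpha|fgker _ [chi dchi <-]]; last first.
  have [alpha [r [r0 chiE]]] := discrete_char_multiple dchi.
  apply/Sigma1P; split; first exact: dchi.1.
  apply: (half_graph_connected_of_fg genX (fgker alpha)); last exact: dchi.1.
    move=> g /(@derived_sub_char_ker R G chi) /= /eqP.
    by rewrite chiE mulf_eq0 gt_eqF //= intr_eq0 => /eqP.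
  by move=> g /= g0; rewrite chiE [alpha g]g0 mulr0.
have [nt|triv] := pselect (exists g, alpha g <> 0 :> int); last first.
  exists X => //; rewrite genX eqEsubset; split=> // g _.
  by apply: contrapT => g1; apply: triv; exists g.
have [s sX] := (finite_seqP X).1 finX.
pose beta g : 'rV[int]_1 := const_mx (alpha g : int).
have betaM x y : beta (x * y)%g = beta x + beta y.
  by apply/rowP => i; rewrite !mxE; exact: (gmulfM (s := alpha)).
apply: (@fg_of_half_graphs_connected R G 1 beta betaM s).
- by rewrite -sX.
- move=> u u0; rewrite -sX; apply/Sigma1P/sub; exists (lin_char betaM u) => //.
  apply: (@discrete_char_of_multiple _ _ _ alpha (u 0 0)) => //.
    apply: contra u0 => /eqP u00; apply/eqP/rowP => i.
    by rewrite ord1 u00 mxE.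
  by move=> g; rewrite lin_charE big_ord1 mxE.
- exact: hom_kernel_subgroup.
- by move=> g g0; apply/rowP => i; rewrite !mxE; exact: g0.
- move=> M; apply: (@finite_representatives _ _ _
    [set g | beta_sqnorm beta g <= M%:Z] beta).
    apply: sub_finite_set (finite_int_ball 1 M).
    by move=> _ [g gM <-].
  move=> g h /rowP/(_ 0); rewrite !mxE => E.
  by rewrite /hom_kernel /= mulg_homF [alpha g]E divgg.
Qed.

Lemma Sigma1_full_of_fg_kernel (X : set G) (N : set G) :
    finite_generating_set X -> fg_subgroup N -> derived_subgroup G `<=` N ->
    (forall chi : realhom R G, N `<=` [set g | chi g = 0 :> R]) ->
  Sigma1 R X = char_sphere R G.
Proof.
move=> [_ genX] fgN DN Nker; rewrite eqEsubset; split.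
  by move=> _ [chi [nt _] <-]; exists chi.
move=> _ [chi nt <-]; exists chi => //; split=> //.
exact: half_graph_connected_of_fg genX fgN DN (Nker chi) nt.
Qed.

(** The coordinates on the abelianization have finite fibers modulo the derived
    subgroup, and a nonzero linear form in them takes a nonzero value on some
    lift of a member of the independent family. *)
Lemma Sigma1_fullP (X : set G) : finite_generating_set X ->
  Sigma1 R X = char_sphere R G <-> fg_subgroup (derived_subgroup G).
Proof.
move=> genX; split=> [full|fgD]; last first.
  exact: Sigma1_full_of_fg_kernel genX fgD _ (@derived_sub_char_ker R G).
have [finX genX'] := genX.
have [s sX] := (finite_seqP X).1 finX; rewrite sX in genX'.
have [k [q [M [M0 indq spanq]]]] := almost_spanning_family (map (@pi_ab G) s).
pose betaM := ab_coordM genX' indq spanq.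
apply: (@fg_of_half_graphs_connected R G k _ betaM s genX').
- move=> u u0.
  have nt : nontrivial (lin_char betaM u).
    have [i ui] : exists i, u 0 i != 0.
      apply: contrapT => H; move/eqP: u0; apply; apply/rowP => i.
      by rewrite mxE; apply: contrapT => /eqP ui; apply: H; exists i.
    have [g gi] := ab_coord_family genX' indq spanq i.
    exists g; rewrite lin_charE (bigD1 i) //= big1 ?addr0 => [|j /negPf ji].
      rewrite gi eqxx => /eqP; rewrite mulf_eq0 (negPf ui) intr_eq0.
      by rewrite eqz_nat eqn0Ngt M0.
    by rewrite gi ji mulr0.
  have : Sigma1 R X (char_class (lin_char betaM u)).
    by rewrite full; exists (lin_char betaM u).
  by move=> /Sigma1P; rewrite sX.
- exact: subgroup_generated.
- exact: ab_coord_derived.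
- exact: finite_ab_coord_fibers.
Qed.

(** The size [k] of an independent family in the abelianization is at most [m],
    so that its coordinates, padded with zeros, form a homomorphism to [Z^m] to
    which the shear construction applies. *)
Lemma Sigma1_full_of_FGFPa (m : nat) (X : set G) :
    (rk_H1 R G <= (m%:R)%:E)%E ->
    FGFPa (G * to_multiplicative 'rV[int]_m)%type -> finite_generating_set X ->
  Sigma1 R X = char_sphere R G.
Proof.
move=> rk_le fgm genX; have [finX genX'] := genX.
have [s sX] := (finite_seqP X).1 finX; rewrite sX in genX'.
have [k [q [M [M0 indq spanq]]]] := almost_spanning_family (map (@pi_ab G) s).
have km : (k <= m)%N.
  rewrite -(ler_nat R) -lee_fin; apply: le_trans rk_le.
  by apply: ereal_sup_ubound; exists k => //; exists q.
move: fgm; rewrite -(subnKC km); set d := (m - k)%N => fgm.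
pose coord := ab_coord genX' spanq.
have betaM : {morph (fun g =>
    row_mx (coord g) 0 : to_multiplicative 'rV[int]_(k + d)) : x y / (x * y)%g}.
  move=> x y; rewrite /coord ab_coordM //.
  have E (a b : 'rV[int]_k) :
      row_mx (a + b) (0 : 'rV_d) = row_mx a 0 + row_mx b 0.
    by rewrite add_row_mx addr0.
  exact: E.
have kerE g : hom_kernel (multiplicative_of betaM) g <-> coord g = 0.
  split=> [g0|g0]; last by rewrite /hom_kernel /= g0; exact: row_mx0.
  have := congr1 lsubmx (g0 : row_mx (coord g) 0 = 0 :> 'rV_(k + d)).
  by rewrite row_mxKl linear0.
have fgker := fg_hom_kernel_of_FGFPa (multiplicative_of betaM) fgm.
apply: (Sigma1_full_of_fg_kernel genX fgker).
  by move=> g Dg; apply/kerE; exact: ab_coord_derived.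
by move=> chi g /kerE; exact: char_eq0_of_coord.
Qed.

End FixedSubgroupsAndSigma.

Theorem theorem3p1 (R : realType) (G : groupType) :
  ((FGFPa (G * to_multiplicative int)%type ->
      FGFPa G /\
      forall X : set G, finite_generating_set X ->
        rational_sphere R G `<=` Sigma1 R X) /\
   (forall X : set G, finite_generating_set X ->
      (rational_sphere R G `<=` Sigma1 R X <->
       forall alpha : {multiplicative G -> to_multiplicative int},
         fg_subgroup (hom_kernel alpha)))) /\
  ((forall m : nat, (rk_H1 R G <= (m%:R)%:E)%E ->
      FGFPa (G * to_multiplicative 'rV[int]_m)%type ->
      (forall n : nat, (0 <= n <= m)%N ->
         FGFPa (G * to_multiplicative 'rV[int]_n)%type) /\
      forall X : set G, finite_generating_set X ->
        Sigma1 R X = char_sphere R G) /\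
   (forall X : set G, finite_generating_set X ->
      (Sigma1 R X = char_sphere R G <-> fg_subgroup (derived_subgroup G)))).
Proof.
split; split.
- move=> fgZ; split.
    by apply: FGFPa_prodl fgZ => a; lia.
  move=> X genX; apply/(rational_sphere_Sigma1P _ genX) => alpha.
  exact: fg_hom_kernel_of_FGFPa.
- exact: rational_sphere_Sigma1P.
- move=> m rk_le fgm; split=> [n /andP[_ nm]|X].
    exact: FGFPa_rV_le nm fgm.
  exact: Sigma1_full_of_FGFPa rk_le fgm.
- exact: Sigma1_fullP.
Qed.
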